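(* Let $n\ge2$ be an integer, let $\Gamma$ be a discrete additive subgroup of $\mathbb{R}^l$ and $\mathbb{G}$ a finite isometric group on $\Gamma$. Let $g_1,\dots,g_m\in\mathbb{G}$, $b_1,\dots,b_m\in\Gamma$, let $S_i(x)=g_i(x)/n+b_i$ for $x\in\mathbb{R}^l$, and let $E=\bigcup_{i=1}^m S_i(E)$ be the self-similar set generated by $S_1,\dots,S_m$. Put $M=2\max_{1\le i\le m}|b_i|/(n-1)$. Consider the finite directed graph with vertex set $\{x\in\Gamma:|x|\le M\}\times\mathbb{G}\times\mathbb{G}$, in which there is an edge from a vertex $(x,g,g')$ to a vertex $(y,h,h')$ if and only if there is a pair $(i,j)\in\{1,\dots,m\}^2$ such that $$(y,h,h')=(nx+g(b_i)-g'(b_j),\ gg_i,\ g'g_j).$$ Call a vertex $(x,g,g')$ original if $(x,g,g')=(b_i-b_j,g_i,g_j)$ for some $i\ne j$, and call a vertex $(x,g,g')$ a boundary vertex if $x=0$ and $g=g'$. Then $E$ has complete overlaps if and only if there is a directed path starting at an original vertex and ending at a boundary vertex.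
   Context: Finite isometric group on $\Gamma$: a finite group $\mathbb{G}$ (under composition) of maps $g:\Gamma\to\Gamma$ with $g(0)=0$ and $|g(a_1)-g(a_2)|=|a_1-a_2|$ for all $a_1,a_2\in\Gamma$; this implies that $g$ can be extended to a linear isometry of $\mathbb{R}^l$, which is again denoted $g$. The self-similar set generated by $S_1,\dots,S_m$ is the unique nonempty compact set $E$ with $E=\bigcup_iS_i(E)$. It has complete overlaps if there are two distinct finite sequences $i_1\cdots i_t$ and $j_1\cdots j_{t'}$ of indices in $\{1,\dots,m\}$ with $S_{i_1}\circ\cdots\circ S_{i_t}\equiv S_{j_1}\circ\cdots\circ S_{j_{t'}}$.
   Formalization: The linear isometries of R^l extending the elements of G are assumed to be chosen compatibly with composition (automatic if Γ spans R^l; the claim can fail otherwise), and l ≥ 1 is assumed (the claim fails for l = 0, m = 1). *)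

(* Defs.v *)
From HB Require Import structures.
From mathcomp Require Import all_boot all_order all_algebra.
From mathcomp Require Import all_classical all_reals all_analysis.

Set Implicit Arguments.
Unset Strict Implicit.
Unset Printing Implicit Defensive.

Import Order.TTheory GRing.Theory Num.Theory numFieldNormedType.Exports.

Local Open Scope classical_set_scope.
Local Open Scope ring_scope.

(* The library norm of 'rV[R]_l is the sup norm, hence this definition; the two
   norms induce the same topology, so [compact] and [isolated] are unaffected. *)
Definition euclid_norm (R : realType) (l : nat) (x : 'rV[R]_l) : R :=
  Num.sqrt (\sum_(k < l) x ord0 k ^+ 2).

Definition additive_subgroup (V : zmodType) (Gam : set V) : Prop :=
  Gam 0 /\ forall x y, Gam x -> Gam y -> Gam (x - y).

Definition discrete_set (T : topologicalType) (A : set T) : Prop :=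
  A `<=` isolated A.

Record finite_isometric_group (R : realType) (l : nat) (Gam : set 'rV[R]_l)
    (G : set (Gam -> Gam)) : Prop := FiniteIsometricGroup {
  fig_finite : finite_set G;
  fig_id : G id;
  fig_comp : forall g h, G g -> G h -> G (g \o h);
  fig_inv : forall g, G g -> exists2 h, G h & h \o g = id /\ g \o h = id;
  fig_zero : forall g, G g -> forall a : Gam, val a = 0 -> val (g a) = 0;
  fig_isometry : forall g, G g -> forall a1 a2 : Gam,
    euclid_norm (val (g a1) - val (g a2)) = euclid_norm (val a1 - val a2) }.

(* When Gam does not span R^l an isometry of Gam has several linear isometric
   extensions. [linear_extension G ext] says that ext selects one for every
   element of G in such a way that the composition of G is that of the
   extensions; if Gam spans R^l, the extensions are unique and [le_comp] is
   automatic. Values of ext outside G are irrelevant. *)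
Record linear_extension (R : realType) (l : nat) (Gam : set 'rV[R]_l)
    (G : set (Gam -> Gam))
    (ext : (Gam -> Gam) -> {linear 'rV[R]_l -> 'rV[R]_l}) : Prop :=
  LinearExtension {
  le_isometry : forall g, G g ->
    forall x, euclid_norm (ext g x) = euclid_norm x;
  le_extends : forall g, G g -> forall a : Gam, ext g (val a) = val (g a);
  le_comp : forall g h, G g -> G h ->
    forall x, ext (g \o h) x = ext g (ext h x) }.

Definition self_similar_set (R : realType) (l m : nat)
    (S : 'I_m -> 'rV[R]_l -> 'rV[R]_l) (E : set 'rV[R]_l) : Prop :=
  [/\ E !=set0, compact E & E = \bigcup_(i in [set: 'I_m]) (S i @` E)].

Definition word_map (T : Type) (m : nat) (S : 'I_m -> T -> T)
    (w : seq 'I_m) : T -> T :=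
  foldr (fun i f => S i \o f) id w.

Definition complete_overlaps (T : Type) (m : nat) (S : 'I_m -> T -> T) : Prop :=
  exists u v : seq 'I_m,
    [/\ u <> [::], v <> [::], u <> v & word_map S u =1 word_map S v].

Section Graph.
Variables (R : realType) (l m n : nat) (Gam : set 'rV[R]_l).
Variables (G : set (Gam -> Gam)) (g : 'I_m -> Gam -> Gam) (b : 'I_m -> Gam).

Definition similitude (ext : (Gam -> Gam) -> {linear 'rV[R]_l -> 'rV[R]_l})
    (i : 'I_m) (x : 'rV[R]_l) : 'rV[R]_l :=
  n%:R^-1 *: ext (g i) x + val (b i).

Definition radius : R :=
  2 * (\big[Num.max/0]_(i < m) euclid_norm (val (b i))) / (n%:R - 1).

Definition triple : Type := (Gam * (Gam -> Gam) * (Gam -> Gam))%type.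

Definition vertex (v : triple) : Prop :=
  let: (x, h, h') := v in [/\ euclid_norm (val x) <= radius, G h & G h'].

Definition edge (v w : triple) : Prop :=
  let: (x, h, h') := v in
  let: (y, k, k') := w in
  [/\ vertex v, vertex w &
    exists i j : 'I_m,
      [/\ val y = n%:R *: val x + val (h (b i)) - val (h' (b j)),
          k = h \o g i & k' = h' \o g j]].

Definition original_vertex (v : triple) : Prop :=
  let: (x, h, h') := v in
  vertex v /\
  exists i j : 'I_m,
    [/\ i != j, val x = val (b i) - val (b j), h = g i & h' = g j].

Definition boundary_vertex (v : triple) : Prop :=
  let: (x, h, h') := v in [/\ vertex v, val x = 0 & h = h'].

(* Paths of length zero are allowed. *)
Definition original_to_boundary_path : Prop :=
  exists (v : triple) (p : seq triple),
    [/\ original_vertex v, path (fun u w => `[< edge u w >]) v p &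
        boundary_vertex (last v p)].

End Graph.

(* Main.v *)
(* Every composition S_w with |w| = t has the form
   S_w(x) = n^(-t) g_w(x) + n^(1-t) c_w with c_w in Gam and
   c_(w i) = n c_w + g_w(b_i). Hence a path in the graph starting at an original
   vertex reads off a pair of words u, v of equal length with distinct first
   letters, its current vertex being (c_u - c_v, g_u, g_v); it is a boundary
   vertex exactly when S_u = S_v. Conversely, if S_u = S_v, then comparing
   contraction ratios gives |u| = |v|, injectivity removes the common prefix,
   and the bound M on the norms propagates backwards from the final value 0,
   because |nx + g(b_i) - g'(b_j)| <= M implies |x| <= M. *)
Require Import Defs.
From HB Require Import structures.
From mathcomp Require Import all_boot all_order all_algebra.
From mathcomp Require Import all_classical all_reals all_analysis.
From mathcomp Require Import ring.

Set Implicit Arguments.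
Unset Strict Implicit.
Unset Printing Implicit Defensive.

Import Order.TTheory GRing.Theory Num.Theory numFieldNormedType.Exports.

Local Open Scope classical_set_scope.
Local Open Scope ring_scope.

(** * The Euclidean norm: Cauchy-Schwarz inequality, triangle inequality, isometries *)

Section EuclidNorm.
Variables (R : realType) (l : nat).
Implicit Types x y : 'rV[R]_l.

Lemma sqr_euclid_norm x : euclid_norm x ^+ 2 = \sum_(k < l) x ord0 k ^+ 2.
Proof. by rewrite sqr_sqrtr // sumr_ge0 // => k _; rewrite sqr_ge0. Qed.

Lemma euclid_norm_ge0 x : 0 <= euclid_norm x.
Proof. exact: sqrtr_ge0. Qed.

Lemma euclid_norm0 : euclid_norm (0 : 'rV[R]_l) = 0.
Proof. by rewrite /euclid_norm big1 ?sqrtr0 // => k _; rewrite mxE expr0n. Qed.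

Lemma euclid_norm0_eq0 x : euclid_norm x = 0 -> x = 0.
Proof.
move=> x0; have := sqr_euclid_norm x; rewrite x0 expr0n /= => /esym/eqP.
rewrite psumr_eq0 => [/allP xk0|k _]; last exact: sqr_ge0.
apply/rowP => k; rewrite mxE; apply/eqP; rewrite -sqrf_eq0.
by apply: xk0; rewrite mem_index_enum.
Qed.

Lemma euclid_normZ a x : euclid_norm (a *: x) = `|a| * euclid_norm x.
Proof.
rewrite /euclid_norm -sqrtr_sqr -sqrtrM ?sqr_ge0// mulr_sumr.
by congr Num.sqrt; apply: eq_bigr => k _; rewrite mxE exprMn.
Qed.

Lemma euclid_normN x : euclid_norm (- x) = euclid_norm x.
Proof. by rewrite -scaleN1r euclid_normZ normrN normr1 mul1r. Qed.

Lemma cauchy_schwarz x y :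
  \sum_(k < l) x ord0 k * y ord0 k <= euclid_norm x * euclid_norm y.
Proof.
have [y0|yn0] := eqVneq (euclid_norm y) 0.
  rewrite y0 mulr0 (euclid_norm0_eq0 y0) big1 // => k _.
  by rewrite mxE mulr0.
have [x0|xn0] := eqVneq (euclid_norm x) 0.
  rewrite x0 mul0r (euclid_norm0_eq0 x0) big1 // => k _.
  by rewrite mxE mul0r.
have y_gt0 : 0 < euclid_norm y by rewrite lt_def yn0 euclid_norm_ge0.
have x_gt0 : 0 < euclid_norm x by rewrite lt_def xn0 euclid_norm_ge0.
(* [d] is chosen so that its sum of squares is a positive multiple, [2 |x| |y|], of the gap in the
   inequality. *)
pose d k := euclid_norm y * x ord0 k - euclid_norm x * y ord0 k.
have : 0 <= \sum_(k < l) d k ^+ 2 by apply: sumr_ge0 => k _; rewrite sqr_ge0.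
have -> : \sum_(k < l) d k ^+ 2 =
    2 * (euclid_norm x * euclid_norm y) * (euclid_norm x * euclid_norm y -
      \sum_(k < l) x ord0 k * y ord0 k).
  transitivity (euclid_norm y ^+ 2 * (\sum_(k < l) x ord0 k ^+ 2) +
      euclid_norm x ^+ 2 * (\sum_(k < l) y ord0 k ^+ 2) -
      2 * (euclid_norm x * euclid_norm y) *
        (\sum_(k < l) x ord0 k * y ord0 k)).
    rewrite !mulr_sumr -big_split -sumrB /=.
    by apply: eq_bigr => k _; rewrite /d; ring.
  by rewrite -!sqr_euclid_norm; ring.
by rewrite pmulr_rge0 ?mulr_gt0// subr_ge0.
Qed.

Lemma ler_euclid_normD x y :
  euclid_norm (x + y) <= euclid_norm x + euclid_norm y.
Proof.
rewrite -ler_sqr ?nnegrE ?addr_ge0 ?euclid_norm_ge0// sqrrD !sqr_euclid_norm.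
have -> : \sum_(k < l) (x + y) ord0 k ^+ 2 = \sum_(k < l) x ord0 k ^+ 2 +
    (\sum_(k < l) x ord0 k * y ord0 k) *+ 2 + \sum_(k < l) y ord0 k ^+ 2.
  rewrite -sumrMnl -!big_split /=.
  by apply: eq_bigr => k _; rewrite mxE sqrrD.
by rewrite lerD2r lerD2l lerMn2r cauchy_schwarz orbT.
Qed.

Lemma isometry_inj (f : {linear 'rV[R]_l -> 'rV[R]_l}) :
  (forall x, euclid_norm (f x) = euclid_norm x) -> injective f.
Proof.
move=> f_iso x y /eqP; rewrite -subr_eq0 -linearB => /eqP fxy0.
apply/eqP; rewrite -subr_eq0; apply/eqP/euclid_norm0_eq0.
by rewrite -f_iso fxy0 euclid_norm0.
Qed.

End EuclidNorm.

(** * Compositions indexed by words *)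

Lemma word_map_cat (T : Type) (m : nat) (S : 'I_m -> T -> T) u v x :
  word_map S (u ++ v) x = word_map S u (word_map S v x).
Proof. by elim: u => //= i u ->. Qed.

Lemma word_map_rcons (T : Type) (m : nat) (S : 'I_m -> T -> T) u i x :
  word_map S (rcons u i) x = word_map S u (S i x).
Proof. by rewrite -cats1 word_map_cat. Qed.

(** Injectivity cancels equal first letters one at a time. Because the lengths agree, neither word
    can be a proper prefix of the other, so the cancellation stops at two different letters. *)
Lemma word_map_split_head (T : Type) (m : nat) (S : 'I_m -> T -> T) u v :
    (forall i, injective (S i)) -> size u = size v -> u <> v ->
    word_map S u =1 word_map S v ->
  exists i j p q, [/\ i != j, size p = size q &
    word_map S (i :: p) =1 word_map S (j :: q)].
Proof.
move=> S_inj; elim: u v => [|i p IHp] [|j q] //= [spq] npq Epq.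
have [eij|nij] := eqVneq i j; last by exists i, j, p, q.
apply: (IHp q) => // [epq|x]; first by apply: npq; rewrite eij epq.
by apply: (S_inj i); rewrite {2}eij; apply: Epq.
Qed.

(** * The similitudes and the affine form of their compositions *)

Section OverlapGraph.
Variables (R : realType) (l m n : nat).
Hypotheses (hl : (0 < l)%N) (hn : (2 <= n)%N).
Variable Gam : set 'rV[R]_l.
Hypothesis hGam : additive_subgroup Gam.
Variable G : set (Gam -> Gam).
Hypothesis hG : finite_isometric_group G.
Variable ext : (Gam -> Gam) -> {linear 'rV[R]_l -> 'rV[R]_l}.
Hypothesis hext : linear_extension G ext.
Variables (g : 'I_m -> Gam -> Gam) (b : 'I_m -> Gam).
Hypothesis hg : forall i, G (g i).

Local Notation S := (similitude n g b ext).
Local Notation nR := (n%:R : R).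

Lemma ratio_gt1 : 1 < nR. Proof. by rewrite ltr1n. Qed.

Lemma ratio_gt0 : 0 < nR. Proof. exact: lt_trans ratio_gt1. Qed.

Lemma ratio_neq0 : nR != 0. Proof. by rewrite gt_eqF ?ratio_gt0. Qed.

Lemma subgroupB (x y : Gam) : Gam (val x - val y).
Proof. by case: hGam => _; apply; apply: set_valP. Qed.

Lemma subgroupD x y : Gam x -> Gam y -> Gam (x + y).
Proof.
case: hGam => Gam0 GamB Gx Gy; rewrite -[y]opprK -[- y]sub0r.
by apply: (GamB) => //; apply: GamB.
Qed.

Lemma subgroupMn x k : Gam x -> Gam (k%:R *: x).
Proof.
move=> Gx; elim: k => [|k IHk]; first by rewrite scale0r; case: hGam.
by rewrite -natr1 scalerDl scale1r; apply: subgroupD.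
Qed.

(** Equality of maps yields equality of linear parts on the whole space, whereas the graph records
    self-maps of [Gam]; this passes from the former to the latter. *)
Lemma extension_val_inj (h h' : Gam -> Gam) : G h -> G h' ->
  ext h =1 ext h' -> h = h'.
Proof.
move=> Gh Gh' Ehh'; apply/funext => a; apply: val_inj.
by rewrite -(le_extends hext Gh) -(le_extends hext Gh').
Qed.

Lemma group_norm (h : Gam -> Gam) a : G h ->
  euclid_norm (val (h a)) = euclid_norm (val a).
Proof. by move=> Gh; rewrite -(le_extends hext Gh) (le_isometry hext). Qed.

Lemma similitude_inj i : injective (S i).
Proof.
have nV0 : nR^-1 != 0 by rewrite invr_neq0 ?ratio_neq0.
move=> x y /addIr /(scalerI nV0).
exact: (isometry_inj (le_isometry hext (hg i))).
Qed.

(* [c] is [n ^ (size w - 1)] times the translation part of [word_map S w]; the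
   scaling makes it an element of [Gam]. *)
Definition normal_form (w : seq 'I_m) (h : Gam -> Gam) (c : 'rV[R]_l) : Prop :=
  G h /\ forall x, nR ^+ size w *: word_map S w x = ext h x + nR *: c.

Lemma normal_form1 i : normal_form [:: i] (g i) (val (b i)).
Proof.
split=> // x; rewrite expr1 /= /similitude scalerDr scalerA.
by rewrite divff ?ratio_neq0 // scale1r.
Qed.

(** Appending a letter on the right acts on [(h, c)] as an edge acts on one side of a vertex:
    subtracting two such updates gives the edge equation. *)
Lemma normal_form_rcons w h c i : normal_form w h c ->
  normal_form (rcons w i) (h \o g i) (nR *: c + val (h (b i))).
Proof.
case=> Gh Ew; split=> [|x]; first exact: (fig_comp hG).
rewrite size_rcons exprS -scalerA word_map_rcons Ew (le_comp hext) //.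
rewrite /similitude (linearD (ext h)) (linearZ_LR (ext h)) (le_extends hext Gh).
rewrite !scalerDr scalerA divff ?ratio_neq0 // scale1r -addrA.
by congr (_ + _); rewrite addrC.
Qed.

Lemma normal_form_ex i w : exists h c, normal_form (i :: w) h c.
Proof.
elim/last_ind: w => [|w j [h [c nf]]].
  by exists (g i), (val (b i)); apply: normal_form1.
by eexists; eexists; rewrite -rcons_cons; apply: normal_form_rcons nf.
Qed.

Lemma normal_form_eq u v h c :
  size u = size v -> normal_form u h c -> normal_form v h c ->
  word_map S u =1 word_map S v.
Proof.
move=> suv [_ Eu] [_ Ev] x.
have nk0 : nR ^+ size u != 0 by rewrite expf_neq0 ?ratio_neq0.
by apply: (scalerI nk0); rewrite Eu suv Ev.
Qed.

Lemma eq_normal_form u v h h' c c' :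
  size u = size v -> word_map S u =1 word_map S v ->
  normal_form u h c -> normal_form v h' c' -> h = h' /\ c = c'.
Proof.
move=> suv Euv [Gh Eu] [Gh' Ev].
have E x : ext h x + nR *: c = ext h' x + nR *: c' by rewrite -Eu -Ev suv Euv.
have ec : c = c'.
  (* Evaluation at 0 removes the linear parts and isolates the translations. *)
  have := E 0; rewrite !linear0 !add0r; exact/scalerI/ratio_neq0.
split=> //; apply: extension_val_inj => // x.
by have := E x; rewrite ec => /addIr.
Qed.

(* The common map contracts distances by [n ^ - size u] and by
   [n ^ - size v]. *)
Lemma word_map_eq_size u v : u <> [::] -> v <> [::] ->
  word_map S u =1 word_map S v -> size u = size v.
Proof.
case: u v => [|i p] [|j q] // _ _ Epq.
have [h [c [Gh Eu]]] := normal_form_ex i p.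
have [h' [c' [Gh' Ev]]] := normal_form_ex j q.
(* Any nonzero vector would serve; the all-ones row is nonzero because [0 < l]. *)
pose e : 'rV[R]_l := const_mx 1.
pose d := word_map S (i :: p) e - word_map S (i :: p) 0.
have nd : nR ^+ size (i :: p) * euclid_norm d = euclid_norm e.
  rewrite -(ger0_norm (exprn_ge0 _ (ltW ratio_gt0))) -euclid_normZ /d.
  rewrite scalerBr !Eu linear0 add0r addrK; exact: (le_isometry hext).
have nd' : nR ^+ size (j :: q) * euclid_norm d = euclid_norm e.
  rewrite -(ger0_norm (exprn_ge0 _ (ltW ratio_gt0))) -euclid_normZ /d.
  rewrite !Epq scalerBr !Ev linear0 add0r addrK; exact: (le_isometry hext).
have ne0 : euclid_norm e != 0.
  apply/eqP => /euclid_norm0_eq0/rowP/(_ (Ordinal hl)).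
  by rewrite !mxE => /eqP; rewrite oner_eq0.
have d0 : euclid_norm d != 0.
  by apply: contraNneq ne0 => d0; rewrite -nd d0 mulr0.
have/(mulIf d0) := etrans nd (esym nd').
by move/(ieexprIn ratio_gt0 (negbT (gt_eqF ratio_gt1))).
Qed.

(** * Norm bound on the vertices; passage between pairs of words and paths *)

Lemma radius_ge0 : 0 <= Defs.radius n b.
Proof.
rewrite /Defs.radius divr_ge0 ?subr_ge0 ?(ltW ratio_gt1)// mulr_ge0 //.
exact: bigmax_ge_id.
Qed.

(* The radius is the fixed point of the bound [r |-> (r + 2 max |b_i|) / n]. *)
Lemma predecessor_norm_le (x y : 'rV[R]_l) h h' i j : G h -> G h' ->
    y = nR *: x + val (h (b i)) - val (h' (b j)) ->
  euclid_norm y <= Defs.radius n b -> euclid_norm x <= Defs.radius n b.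
Proof.
move=> Gh Gh' Ey ny.
set B := \big[Num.max/0]_(i < m) euclid_norm (val (b i)).
have nb k f : G f -> euclid_norm (val (f (b k))) <= B.
  move=> Gf; rewrite group_norm //.
  exact: (@le_bigmax _ _ _ _ (fun i => euclid_norm (val (b i)))).
have Er : Defs.radius n b * (nR - 1) = 2 * B.
  by rewrite /Defs.radius divfK // subr_eq0 gt_eqF ?ratio_gt1.
have nx : nR * euclid_norm x <= euclid_norm y + (B + B).
  rewrite -[nR]ger0_norm ?(ltW ratio_gt0)// -euclid_normZ.
  have -> : nR *: x = y + (val (h' (b j)) - val (h (b i))).
    by rewrite Ey addrA subrK addrK.
  apply: le_trans (ler_euclid_normD _ _) _; rewrite lerD2l.
  apply: le_trans (ler_euclid_normD _ _) _.
  by rewrite euclid_normN lerD ?nb.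
rewrite -(ler_pM2l ratio_gt0); apply: le_trans nx _.
have -> : nR * Defs.radius n b = Defs.radius n b + (B + B).
  have -> : B + B = 2 * B by ring.
  by rewrite -Er; ring.
by rewrite lerD2r.
Qed.

(** Here [u], [v] are the letters already read and [p], [q] those still to be read. The vertex claim
    is part of the induction because the norm bound is known only at the end, where [x = 0], and is
    carried back from each successor by [predecessor_norm_le]. *)
Lemma path_of_overlap p q u v h h' c c' (x : Gam) :
    size p = size q -> size u = size v ->
    normal_form u h c -> normal_form v h' c' -> val x = c - c' ->
    word_map S (u ++ p) =1 word_map S (v ++ q) ->
  vertex n G b (x, h, h') /\
  exists2 s, path (fun a a' => `[< edge n G g b a a' >]) (x, h, h') s &
    boundary_vertex n G b (last (x, h, h') s).
Proof.
elim: p q u v h h' c c' x => [|i p IHp] [|j q] // u v h h' c c' x.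
  rewrite !cats0 => _ suv nfu nfv Ex Euv.
  have [eh ec] := eq_normal_form suv Euv nfu nfv.
  have x0 : val x = 0 by rewrite Ex ec subrr.
  have vx : vertex n G b (x, h, h').
    split; [|exact: nfu.1|exact: nfv.1].
    by rewrite x0 euclid_norm0 radius_ge0.
  by split=> //; exists [::].
move=> [spq] suv nfu nfv Ex Euv.
have Gy : Gam (nR *: val x + val (h (b i)) - val (h' (b j))).
  case: (hGam) => _; apply; last exact: set_valP.
  by apply: subgroupD; [apply: subgroupMn|]; apply: set_valP.
pose y : Gam := SigSub (mem_set Gy).
have [|||vy [s path_s last_s]] := IHp q (rcons u i) (rcons v j) _ _ _ _ y
  spq _ (normal_form_rcons i nfu) (normal_form_rcons j nfv).
- by rewrite !size_rcons suv.
- by rewrite /= Ex scalerBr opprD !addrA; congr (_ - _); rewrite addrAC.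
- by rewrite !cat_rcons.
have vx : vertex n G b (x, h, h').
  split; [|exact: nfu.1|exact: nfv.1].
  by case: vy => ny _ _; apply: predecessor_norm_le nfu.1 nfv.1 _ ny.
split=> //; exists ((y, h \o g i, h' \o g j) :: s) => //=.
rewrite path_s andbT; apply/asboolP; split=> //.
by exists i, j.
Qed.

(** Induction along the path keeps the current vertex equal to [(c - c', h, h')]. Each edge appends
    one letter to both words, which preserves their equal length and, [rcons] being injective, their
    distinctness. *)
Lemma overlap_of_path s u v h h' c c' (x : Gam) :
    u <> [::] -> v <> [::] -> u <> v -> size u = size v ->
    normal_form u h c -> normal_form v h' c' -> val x = c - c' ->
    path (fun a a' => `[< edge n G g b a a' >]) (x, h, h') s ->
    boundary_vertex n G b (last (x, h, h') s) ->
  complete_overlaps S.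
Proof.
elim: s u v h h' c c' x => [|[[y k] k'] s IHs] u v h h' c c' x /=.
  move=> u0 v0 nuv suv nfu nfv Ex _ [_ x0 eh].
  exists u, v; split=> //; apply: (normal_form_eq suv nfu).
  by rewrite eh; have /subr0_eq -> : c - c' = 0 by rewrite -Ex.
move=> u0 v0 nuv suv nfu nfv Ex /andP[/asboolP[_ _ [i [j [Ey -> ->]]]]].
apply: (IHs (rcons u i) (rcons v j)).
- by case: (u).
- by case: (v).
- by move/rcons_inj => -[].
- by rewrite !size_rcons suv.
- exact: normal_form_rcons nfu.
- exact: normal_form_rcons nfv.
- by rewrite [LHS]Ey Ex scalerBr opprD !addrA; congr (_ - _); rewrite addrAC.
Qed.

Lemma complete_overlaps_path :
  complete_overlaps S <-> original_to_boundary_path n G g b.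
Proof.
split=> [[u [v [u0 v0 nuv Euv]]]|[[[x h] h'] [s [[_ [i [j [nij Ex -> ->]]]]]]]].
  have suv := word_map_eq_size u0 v0 Euv.
  have [i [j [p [q [nij spq Epq]]]]] :=
    word_map_split_head similitude_inj suv nuv Euv.
  pose x : Gam := SigSub (mem_set (subgroupB (b i) (b j))).
  have [vx [s path_s last_s]] := @path_of_overlap p q [:: i] [:: j] _ _ _ _ x
    spq erefl (normal_form1 i) (normal_form1 j) erefl Epq.
  by exists (x, g i, g j), s; split=> //; split=> //; exists i, j.
(* An original vertex is the state reached by two different one-letter words. *)
apply: (overlap_of_path (u := [:: i]) (v := [:: j])) => //.
- by move=> [eij]; rewrite eij eqxx in nij.
- exact: normal_form1.
- exact: normal_form1.
- exact: Ex.
Qed.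

End OverlapGraph.

Theorem proposition1 (R : realType) (l m n : nat)
    (hl : (0 < l)%N) (hm : (0 < m)%N) (hn : (2 <= n)%N)
    (Gam : set 'rV[R]_l)
    (hGam : additive_subgroup Gam) (hdisc : discrete_set Gam)
    (G : set (Gam -> Gam)) (hG : finite_isometric_group G)
    (ext : (Gam -> Gam) -> {linear 'rV[R]_l -> 'rV[R]_l})
    (hext : linear_extension G ext)
    (g : 'I_m -> Gam -> Gam) (hg : forall i, G (g i))
    (b : 'I_m -> Gam)
    (E : set 'rV[R]_l) (hE : self_similar_set (similitude n g b ext) E) :
  complete_overlaps (similitude n g b ext) <->
  original_to_boundary_path n G g b.
Proof. exact: complete_overlaps_path. Qed.
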